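(* Let $n,d,r$ be positive integers and let $\pi\in\mathcal{OP}(n,d,r)$. Then the $r$-jellyfish invariant $[\pi]_r$ lies in the flamingo Specht module $S^{(d^r,1^{n-rd})}\subseteq\mathbb{C}[M]$.
   Context: An ordered set partition of $[n]=\{1,\dots,n\}$ with $d$ blocks is a sequence $\pi=(\pi_1\mid\cdots\mid\pi_d)$ of nonempty pairwise disjoint subsets of $[n]$ whose union is $[n]$; $\mathcal{OP}(n,d,r)$ is the set of such with every block of size at least $r$ (so $rd\le n$). Let $M=(x_{ij})_{1\le i,j\le n}$ be an $n\times n$ matrix of distinct indeterminates and $\mathbb{C}[M]$ the polynomial ring in them. For $I,J\subseteq[n]$ with $|I|=|J|$, $M_I^J$ is the determinant of the submatrix of $M$ with rows $I$ and columns $J$, each taken in increasing order. For $\pi\in\mathcal{OP}(n,d,r)$, an $r$-jellyfish tableau for $\pi$ is an array $T$ with $n-(d-1)r$ rows and $d$ columns, each cell empty or containing an element of $[n]$, such that: every cell in rows $1,\dots,r$ is nonempty; each row $i>r$ has exactly one nonempty cell; and the nonempty entries of column $j$ are exactly the elements of $\pi_j$, increasing from top to bottom. Let $\mathcal{J}_r(\pi)$ be the set of these. The sign $\mathrm{sgn}(T)=(-1)^{\mathrm{inv}(T)}$, where $\mathrm{inv}(T)$ is the number of inversions (pairs of entries appearing in decreasing order) of the row reading word of $T$ (entries read left to right within each row, rows from top to bottom, empty cells skipped). Put $\mathrm{J}(T)=\prod_{j=1}^d M^{\pi_j}_{R_j(T)}$, where $R_j(T)$ is the set of indices of rows in which column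 $j$ of $T$ is nonempty. The $r$-jellyfish invariant is $[\pi]_r=\sum_{T\in\mathcal{J}_r(\pi)}\mathrm{sgn}(T)\,\mathrm{J}(T)$. The flamingo Specht module $S^{(d^r,1^{n-rd})}$ is the $\mathbb{C}$-linear span in $\mathbb{C}[M]$ of all products $M^{J_0}_{\{1,\dots,n-rd+r\}}\prod_{i=1}^{d-1}M^{J_i}_{\{1,\dots,r\}}$, where $(J_0,J_1,\dots,J_{d-1})$ ranges over sequences of pairwise disjoint subsets of $[n]$ with union $[n]$, $|J_0|=n-rd+r$ and $|J_i|=r$ for $i\ge1$ (products of top-justified minors); with $\mathfrak{S}_n$ permuting columns of $M$, it is the irreducible representation of $\mathfrak{S}_n$ indexed by the partition $(d^r,1^{n-rd})$. *)

(* Defs.v *)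
From HB Require Import structures.
From mathcomp Require Import all_boot all_order all_algebra.
From mathcomp Require Import mpoly complex reals.

Set Implicit Arguments.
Unset Strict Implicit.
Unset Printing Implicit Defensive.

Import GRing.Theory.
Local Open Scope ring_scope.

(* The set [n] is represented by 'I_n, so rows and columns are numbered from 0:
   "rows 1, ..., r" are the rows i with i < r. *)

Section Blocks.

Variables n d : nat.

(* Disjointness is required of distinct positions, so that a block cannot be
   repeated; this is why trivIset (a property of sets of sets) is not used. *)
Definition ordered_cover (B : {ffun 'I_d -> {set 'I_n}}) : bool :=
  [forall i, forall j, (i != j) ==> [disjoint B i & B j]]
  && (\bigcup_i B i == [set: 'I_n]).

Definition OP (r : nat) : {set {ffun 'I_d -> {set 'I_n}}} :=
  [set B | [&& ordered_cover B, [forall j, B j != set0]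
             & [forall j, (r <= #|B j|)%N]]].

End Blocks.

Section Minors.

Variables (K : fieldType) (n : nat).

(* The n ^ 2 indeterminates are numbered by the bijection mxvec_index. *)
Definition generic_mx : 'M[{mpoly K[n * n]}]_n :=
  \matrix_(i, j) 'X_(mxvec_index i j).

(* M_I^J, intended for #|I| = #|J|: both enum I and enum J are increasing, and
   the default value of nth is then never reached. *)
Definition minor (I J : {set 'I_n}) : {mpoly K[n * n]} :=
  \det (\matrix_(a < #|I|, b < #|I|)
          generic_mx (enum_val a) (nth (enum_val a) (enum J) b)).

End Minors.

Section Jellyfish.

Variables n d r : nat.

Definition nrows : nat := (n - d.-1 * r)%N.

Definition tableau : predArgType := 'M[option 'I_n]_(nrows, d).

Definition col_word (T : tableau) (j : 'I_d) : seq 'I_n :=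
  pmap (fun i => T i j) (enum 'I_nrows).

Definition row_word (T : tableau) (i : 'I_nrows) : seq 'I_n :=
  pmap (fun j => T i j) (enum 'I_d).

Definition reading_word (T : tableau) : seq 'I_n :=
  flatten [seq row_word T i | i <- enum 'I_nrows].

Definition jellyfish (B : {ffun 'I_d -> {set 'I_n}}) (T : tableau) : bool :=
  [&& [forall i : 'I_nrows, forall j, (i < r)%N ==> (T i j != None)],
      [forall i : 'I_nrows, (r <= i)%N ==> (#|[set j | T i j != None]| == 1%N)]
    & [forall j, ([set x in col_word T j] == B j)
                 && sorted (fun x y : 'I_n => (x < y)%N) (col_word T j)]].

Definition inversions (w : seq nat) : nat :=
  #|[set p : 'I_(size w) * 'I_(size w) |
       (p.1 < p.2)%N && (nth 0%N w p.2 < nth 0%N w p.1)%N]|.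

Definition inv_tab (T : tableau) : nat :=
  inversions [seq val x | x <- reading_word T].

Definition col_rows (T : tableau) (j : 'I_d) : {set 'I_n} :=
  [set widen_ord (leq_subr (d.-1 * r) n) i | i in [set i | T i j != None]].

Variable K : fieldType.

Definition Jtab (B : {ffun 'I_d -> {set 'I_n}}) (T : tableau) :
    {mpoly K[n * n]} :=
  \prod_(j < d) minor K (col_rows T j) (B j).

Definition jellyfish_invariant (B : {ffun 'I_d -> {set 'I_n}}) :
    {mpoly K[n * n]} :=
  \sum_(T : tableau | jellyfish B T) (-1) ^+ inv_tab T * Jtab B T.

End Jellyfish.

Arguments jellyfish_invariant {n d} r K B.

Section Specht.

Variables (n d r : nat) (K : fieldType).

(* The common size of J_i and of the set of rows of the i-th minor, i.e. the
   i-th column length of the partition (d^r, 1^(n - rd)), for r * d <= n. *)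
Definition flamingo_col (i : nat) : nat :=
  if i == 0%N then (n - r * d + r)%N else r.

Definition flamingo_index (J : {ffun 'I_d -> {set 'I_n}}) : bool :=
  ordered_cover J && [forall i : 'I_d, #|J i| == flamingo_col i].

Definition flamingo_generator (J : {ffun 'I_d -> {set 'I_n}}) :
    {mpoly K[n * n]} :=
  \prod_(i < d) minor K [set a : 'I_n | (a < flamingo_col i)%N] (J i).

(* Membership in the K-linear span of the finite family of generators. *)
Definition flamingo_specht (f : {mpoly K[n * n]}) : Prop :=
  exists c : {ffun 'I_d -> {set 'I_n}} -> K,
    f = \sum_(J | flamingo_index J) c J *: flamingo_generator J.

End Specht.

Arguments flamingo_specht n d r {K} f.

(* Main.v *)
(* Write x_i for the i-th row of M, and x_i^(k) for x_i with the entries outside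
   the columns of pi_k replaced by 0. In the reading order of the tableaux, let
   Z be the n x n matrix with one row x_i^(k) for each i < r and each k > 0, and
   one row x_i for each row i of the tableaux (at position (i, 0) if i < r).
   Splitting every x_i as the sum of the x_i^(k), det Z becomes a sum over
   labellings of the rows by blocks. A labelling with k > 0 at (i, 0) repeats
   the row x_i^(k), so only the rows i >= r are really free, and the remaining
   labellings are the jellyfish tableaux: det Z = [pi]_r, signs included.
   On the other hand, Laplace expansion of det Z along the groups of rows
   {(i, k) : i < r}, k > 0, and the group of all the x_i gives only products
   of top-justified minors of M of sizes r, ..., r and n - rd + r. *)

Require Import Defs.
From mathcomp Require Import all_boot all_order all_algebra fingroup perm.
From mathcomp Require Import zify.
From mathcomp Require Import mpoly complex reals.

Set Implicit Arguments.
Unset Strict Implicit.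
Unset Printing Implicit Defensive.

Import GRing.Theory Num.Theory.
Local Open Scope ring_scope.

(** * Inversions and the sign of a permutation *)

Lemma prodr_sg_inversion n (s : 'S_n) :
  \prod_(i < n) \prod_(j < n | (i < j)%N)
     Num.sg (((s j : nat)%:Z : int) - (s i : nat)%:Z)
  = (-1) ^+ (\sum_(i < n) \sum_(j < n) ((i < j) && (s j < s i)))%N.
Proof.
rewrite -prodrXr; apply: eq_bigr => i _.
rewrite -prodrXr big_mkcond /=; apply: eq_bigr => j _.
case: ltnP => //= lt_ij.
have /eqP s_neq : s i != s j by rewrite (inj_eq perm_inj) -val_eqE /= ltn_eqF.
case: (ltnP (s j) (s i)) => lt_s.
  by rewrite ltr0_sg // subr_lt0 ltz_nat.
rewrite gtr0_sg // subr_gt0 ltz_nat ltn_neqAle lt_s andbT.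
by apply/eqP => /val_inj.
Qed.

(* Permuting the nodes 0, ..., n - 1 of a Vandermonde determinant by s multiplies
   it by the sign of s and flips one factor per inversion. *)
Lemma odd_perm_inversions n (s : 'S_n) :
  (-1) ^+ (\sum_(i < n) \sum_(j < n) ((i < j) && (s j < s i)))%N
  = (-1) ^+ s :> int.
Proof.
pose a : 'rV[int]_n := \row_i (i : nat)%:Z.
have V0 : \det (Vandermonde n a) != 0.
  rewrite det_Vandermonde; apply/prodf_neq0 => i _; apply/prodf_neq0 => j lt_ij.
  by rewrite !mxE subr_eq0 eqz_nat gtn_eqF.
have Vs : Vandermonde n (col_perm s a) = col_perm s (Vandermonde n a).
  by apply/matrixP => i j; rewrite !mxE.
have := congr1 Num.sg (congr1 determinant Vs).
rewrite [col_perm s (Vandermonde n a)]col_permE det_mulmx det_perm odd_permV.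
have sg_prod : {morph (@Num.sg int) : x y / x * y} by exact: sgrM.
rewrite sgrM !det_Vandermonde.
rewrite !(big_morph _ sg_prod (sgr1 _)).
under eq_bigr do rewrite (big_morph _ sg_prod (sgr1 _)).
under eq_bigr do under eq_bigr do rewrite !mxE.
rewrite prodr_sg_inversion => ->.
(* With the nodes in their natural order all differences are positive, so their signs multiply to
   1. *)
rewrite big1 ?mul1r => [|i _].
  by case: (odd_perm s); rewrite ?expr0 ?expr1 ?sgr1 // sgrN1.
rewrite (big_morph _ sg_prod (sgr1 _)) big1 // => j lt_ij.
by rewrite !mxE gtr0_sg // subr_gt0 ltz_nat.
Qed.

Lemma sign_inversions (A : pzRingType) n (s : 'S_n) :
  (-1) ^+ inversions [seq val (s i) | i <- enum 'I_n] = (-1) ^+ s :> A.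
Proof.
(* Only the parity matters, and it can be read off from signs in [int], where 1 and -1 differ. *)
suff E : odd (inversions [seq val (s i) | i <- enum 'I_n]) = s.
  by rewrite -signr_odd E.
have inv_sum w : inversions w = (\sum_(i < size w) \sum_(j < size w)
    ((i < j) && (nth 0 w j < nth 0 w i)))%N.
  rewrite pair_big /inversions -sum1_card big_mkcond /=.
  by apply: eq_bigr => p _; rewrite inE; case: andP.
have nth_w (k : 'I_n) : nth 0%N [seq val (s i) | i <- enum 'I_n] k = s k.
  by rewrite (nth_map k) ?size_enum_ord ?nth_ord_enum.
have := odd_perm_inversions s; rewrite -signr_odd inv_sum size_map -cardE card_ord.
set u := (\sum_i _)%N; set v := (\sum_i _)%N; suff -> : v = u.
  by case: (odd u); case: (odd_perm s).
apply: eq_bigr => i _; apply: eq_bigr => j _.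
by rewrite !nth_w.
Qed.

(** * Determinants of matrices cut into blocks by a labelling *)

Section Determinants.

Variable K : comPzRingType.

Lemma det_castmx m n (e : m = n) (A : 'M[K]_m) : \det (castmx (e, e) A) = \det A.
Proof. by case: n / e. Qed.

(** Rows and columns are reordered in the same way, so the two signs cancel. *)
Lemma det_mxsub_bij m n (phi : 'I_m -> 'I_n) (A : 'M[K]_n) :
  bijective phi -> \det (mxsub phi phi A) = \det A.
Proof.
move=> bij_phi; have e : m = n by move: (bij_eq_card bij_phi); rewrite !card_ord.
subst m; have inj_phi := bij_inj bij_phi.
have -> : mxsub phi phi A = row_perm (perm inj_phi) (col_perm (perm inj_phi) A).
  by apply/matrixP => i j; rewrite !mxE !permE.
rewrite row_permE col_permE !det_mulmx !det_perm odd_permV mulrCA.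
by rewrite -signr_addb addbb mulr1.
Qed.

Lemma det_mxdiag m (p : 'I_m -> nat) (B : forall i, 'M[K]_(p i)) :
  \det (\mxdiag_i B i) = \prod_i \det (B i).
Proof.
elim: m p B => [|m IHm] p B.
  rewrite [RHS]big_ord0; move: (mxdiag B).
  by rewrite big_ord0 => A; exact: det_mx00.
rewrite mxdiag_recl det_castmx det_ublock IHm big_ord_recl.
by [].
Qed.

(** Listing the positions fiber by fiber, for rows and columns alike, makes the matrix block
    diagonal. *)
Lemma det_block_labels n d (f : 'I_n -> 'I_d) (X : 'M[K]_n) :
  \det (\matrix_(p, q) (X p q *+ (f q == f p)))
  = \prod_k \det (mxsub (fun a : 'I_#|[set p | f p == k]| => enum_val a)
                        (fun a => enum_val a) X).
Proof.
pose F k := [set p | f p == k].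
pose phi (s : 'I_(\sum_k #|F k|)) : 'I_n := enum_val (tagnat.sig2 s).
have f_phi s : f (phi s) = tagnat.sig1 s.
  by have := enum_valP (tagnat.sig2 s); rewrite inE => /eqP.
have phi_inj : injective phi.
  move=> s t e; apply: tagnat.sig_inj; rewrite !tagnat.sigE12.
  have := f_phi s; rewrite e f_phi; move: e; rewrite /phi.
  move: (tagnat.sig2 s) (tagnat.sig2 t); move: (tagnat.sig1 s) (tagnat.sig1 t).
  by move=> k l a b; move=> + e; subst l => /enum_val_inj ->.
have phi_bij : bijective phi.
  apply: inj_card_bij => //; rewrite !card_ord.
  rewrite -[leqLHS]card_ord -sum1_card (partition_big f predT) //=.
  by apply: leq_sum => k _; rewrite sum1_card cardsE.
rewrite -(det_mxsub_bij _ phi_bij) -det_mxdiag; congr determinant.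
apply/matrixP => s t; rewrite !mxE !f_phi /phi.
move: (tagnat.sig2 s) (tagnat.sig2 t); move: (tagnat.sig1 s) (tagnat.sig1 t).
move=> k l a b; rewrite eq_sym; case: eqVneq => [e|_]; last by rewrite mulr0n mxE.
by subst l; rewrite conform_mx_id !mxE.
Qed.

(** Permuting the columns by [s] brings those of [G k] under the fiber of [k], in increasing order,
    which reduces to [det_block_labels]. *)
Lemma det_block_shuffle n d (f : 'I_n -> 'I_d) (G : 'I_d -> {set 'I_n})
    (s : 'S_n) (X : 'M[K]_n) :
    (forall k, map s (enum [set p | f p == k]) = enum (G k)) ->
  \det (\matrix_(p, q) (X p q *+ (q \in G (f p))))
  = (-1) ^+ s *
    \prod_k \det (\matrix_(a < #|[set p | f p == k]|, b < #|[set p | f p == k]|)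
                    X (enum_val a) (nth (enum_val a) (enum (G k)) b)).
Proof.
move=> sG; have G_s p k : (s p \in G k) = (f p == k).
  by rewrite -mem_enum -sG mem_map ?mem_enum ?inE //; apply: perm_inj.
set Y := \matrix_(p, q) _; have -> : \det Y = (-1) ^+ s * \det (col_perm s Y).
  rewrite col_permE det_mulmx det_perm odd_permV mulrCA.
  by rewrite -signr_addb addbb mulr1.
have -> : col_perm s Y =
    \matrix_(p, q) ((\matrix_(p', q') X p' (s q')) p q *+ (f q == f p)).
  by apply/matrixP => p q; rewrite !mxE G_s.
rewrite det_block_labels; congr (_ * _); apply: eq_bigr => k _.
congr determinant; apply/matrixP => a b; rewrite !mxE -sG.
by rewrite (nth_map (enum_val a)) -?enum_val_nth // -cardE.
Qed.

End Determinants.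

(** * Expansions of a determinant along labellings *)

Section Labels.

Variables (n d : nat).
Implicit Types (f : 'I_n -> 'I_d) (B : {ffun 'I_d -> {set 'I_n}}).

Lemma ordered_cover_label B : ordered_cover B ->
  exists g : 'I_n -> 'I_d, forall q k, (q \in B k) = (g q == k).
Proof.
case/andP=> /'forall_'forall_implyP disjB /eqP covB.
have [g gB] : exists g : 'I_n -> 'I_d, forall q, q \in B (g q).
  apply: (@fin_all_exists _ _ (fun q k => q \in B k)) => q.
  have : q \in \bigcup_i B i by rewrite covB inE.
  by case/bigcupP=> k _ qk; exists k.
exists g => q k; apply/idP/eqP => [qk | <- //].
apply/eqP/contraT => /disjB/disjointFr/(_ (gB q)).
by rewrite qk.
Qed.

Definition fiber f k : {set 'I_n} := [set p | f p == k].

Definition balanced f (G : 'I_d -> {set 'I_n}) : bool :=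
  [forall k, #|fiber f k| == #|G k|].

(* When f is balanced with respect to G, this maps each fiber of f
   increasingly onto the corresponding set of G. *)
Definition transfer f (G : 'I_d -> {set 'I_n}) (p : 'I_n) : 'I_n :=
  nth p (enum (G (f p))) (index p (enum (fiber f (f p)))).

Lemma map_transfer f G k : balanced f G ->
  map (transfer f G) (enum (fiber f k)) = enum (G k).
Proof.
move/forallP/(_ k)/eqP => eq_k.
(* An empty fiber is set apart because [nth] needs a default value. *)
case: (pickP (mem (fiber f k))) => [p0 _|Fk0]; last first.
  have /eqP := eq_k; rewrite (eq_card0 Fk0) eq_sym => /eqP/card0_eq Gk0.
  by rewrite (eq_enum Fk0) (eq_enum Gk0) enum0.
apply: (@eq_from_nth _ p0) => [|b]; rewrite size_map -!cardE // => ltb.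
have ltb' : (b < size (enum (fiber f k)))%N by rewrite -cardE.
rewrite (nth_map p0) // /transfer.
have := mem_nth p0 ltb'; rewrite mem_enum inE => /eqP ->.
by rewrite index_uniq ?enum_uniq //; apply: set_nth_default; rewrite -cardE -eq_k.
Qed.

Lemma transfer_in f G p : balanced f G -> transfer f G p \in G (f p).
Proof.
move=> fG; rewrite -mem_enum -(map_transfer _ fG).
by apply: map_f; rewrite mem_enum inE.
Qed.

Lemma transfer_inj f B : ordered_cover B -> balanced f B -> injective (transfer f B).
Proof.
move=> /ordered_cover_label[g gB] fB p q e.
have g_tr x : g (transfer f B x) = f x by apply/eqP; rewrite -gB transfer_in.
have f_eq : f p = f q by rewrite -!g_tr e.
have /dinjectiveP inj_f : dinjectiveb (transfer f B) (fiber f (f p)).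
  by rewrite /dinjectiveb /image_mem map_transfer // enum_uniq.
by apply: inj_f; rewrite ?inE ?f_eq.
Qed.

Variable K : comPzRingType.
Implicit Type Z : 'M[K]_n.

(** A nonzero Leibniz term would come from a permutation mapping each fiber of [f] onto its block,
    which forces equal cardinals. *)
Lemma det_unbalanced f B Z : ordered_cover B -> ~~ balanced f B ->
  \det (\matrix_(p, q) (Z p q *+ (q \in B (f p)))) = 0.
Proof.
move=> covB /forallP unb; rewrite /determinant big1 // => s _.
case: (boolP [forall p, s p \in B (f p)]) => [/forallP sB | /forallPn[p /negPf sp]].
  case: unb => k; rewrite -(card_imset _ (@perm_inj _ s)); apply/eqP.
  congr #|pred_of_set _|; apply/setP => q; apply/imsetP/idP => [[p + ->] | qk].
    by rewrite inE => /eqP <-.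
  exists ((s^-1)%g q); last by rewrite permKV.
  have [g gB] := ordered_cover_label covB.
  have := sB ((s^-1)%g q); rewrite permKV inE !gB in qk * => /eqP <-.
  by rewrite (eqP qk).
by rewrite (bigD1 p) //= mxE sp mulr0n mul0r mulr0.
Qed.

(** This is multilinearity in the rows, each row being the sum of its restrictions to the blocks.
    The Leibniz term of [s] survives only for the [f] that sends [p] to the block of [s p]. *)
Lemma det_expand_row_labels B Z : ordered_cover B ->
  \det Z = \sum_(f : {ffun 'I_n -> 'I_d})
             \det (\matrix_(p, q) (Z p q *+ (q \in B (f p)))).
Proof.
move=> /ordered_cover_label[g gB].
rewrite [LHS](partition_big (fun s : 'S_n => [ffun p => g (s p)]) predT) //=.
apply: eq_bigr => f _; rewrite big_mkcond; apply: eq_bigr => s _.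
case: eqP => [<- | neq].
  by congr (_ * _); apply: eq_bigr => p _; rewrite mxE gB ffunE eqxx.
have /existsP[p sp] : [exists p, g (s p) != f p].
  apply: contra_notT neq => /existsPn sf; apply/ffunP => p; rewrite ffunE.
  by apply/eqP; rewrite -[_ == _]negbK sf.
by rewrite (bigD1 p) //= mxE gB (negPf sp) mulr0n mul0r mulr0.
Qed.

(** This is Laplace expansion along the groups of rows given by the fibers of [f]: the Leibniz term
    of [s] survives only when each [J k] is the image of a fiber under [s]. *)
Lemma det_expand_col_labels f Z :
  \det Z = \sum_(J : {ffun 'I_d -> {set 'I_n}} | ordered_cover J && balanced f J)
             \det (\matrix_(p, q) (Z p q *+ (q \in J (f p)))).
Proof.
pose im (s : 'S_n) := [ffun k => s @: fiber f k].
rewrite [LHS](partition_big im (fun J => ordered_cover J && balanced f J)) /=; last first.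
  move=> s _; apply/andP; split; last first.
    by apply/forallP => k; rewrite ffunE card_imset //; apply: perm_inj.
  apply/andP; split.
    apply/'forall_'forall_implyP => k l neq_kl; rewrite !ffunE.
    rewrite disjoint_subset; apply/subsetP => q /imsetP[p + ->].
    rewrite !inE mem_imset; last exact: perm_inj.
    by rewrite inE => /eqP ->.
  rewrite eqEsubset subsetT /=; apply/subsetP => q _.
  apply/bigcupP; exists (f ((s^-1)%g q)) => //; rewrite ffunE.
  by rewrite -{1}(permKV s q) mem_imset ?inE //; apply: perm_inj.
apply: eq_bigr => J /andP[covJ /forallP balJ].
rewrite big_mkcond; apply: eq_bigr => s _; case: eqP => [<- | neq].
  congr (_ * _); apply: eq_bigr => p _; rewrite mxE ffunE mem_imset ?inE ?eqxx //.
  exact: perm_inj.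
have /existsP[p sp] : [exists p, s p \notin J (f p)].
  apply: contra_notT neq => /existsPn sJ; apply/ffunP => k; rewrite ffunE.
  apply/eqP; rewrite eqEcard card_imset; last exact: perm_inj.
  rewrite (eqP (balJ k)) leqnn andbT; apply/subsetP => q /imsetP[p + ->].
  by rewrite inE => /eqP <-; have := sJ p; rewrite negbK.
by rewrite (bigD1 p) //= mxE (negPf sp) mulr0n mul0r mulr0.
Qed.

End Labels.

(** * Increasing enumerations of sets of ordinals *)

Section Ordinals.

Variable n : nat.
Implicit Types (A : {set 'I_n}) (s : seq 'I_n).

Let ltI (x y : 'I_n) := (x < y)%N.

Lemma sorted_enum A : sorted ltI (enum A).
Proof.
rewrite /enum_mem; apply: sorted_filter.
  by move=> y x z; apply: ltn_trans.
by have := iota_ltn_sorted 0 n; rewrite -val_enum_ord sorted_map enumT.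
Qed.

Lemma sorted_eq_enum A s : sorted ltI s -> s =i A -> s = enum A.
Proof.
move=> s_sorted sA; apply: (irr_sorted_eq _ _ s_sorted (sorted_enum A)).
- by move=> y x z; apply: ltn_trans.
- by move=> x; apply: ltnn.
- by move=> x; rewrite mem_enum sA.
Qed.

End Ordinals.

Lemma enum_imset_incr m n (phi : 'I_m -> 'I_n) (A : {set 'I_m}) :
    {in A &, forall x y : 'I_m, (x < y)%N -> (phi x < phi y)%N} ->
  enum (phi @: A) = map phi (enum A).
Proof.
move=> phi_incr; apply/esym/sorted_eq_enum => [|y].
  rewrite sorted_map; apply: (sub_in_sorted (P := mem A)) (sorted_enum A) => //.
  by apply/allP => x; rewrite mem_enum.
by apply/mapP/imsetP => -[x Ax ->]; exists x; rewrite // mem_enum in Ax *.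
Qed.

(** Serves for matrices whose sizes, such as cardinals of two sets, are equal but not
    convertible. *)
Lemma det_ord_val (K : comPzRingType) m n (A : 'M[K]_m) (B : 'M[K]_n) : m = n ->
    (forall i j i' j', val i = val i' -> val j = val j' -> A i j = B i' j') ->
  \det A = \det B.
Proof.
move=> e; subst m => eqAB; congr determinant.
by apply/matrixP => i j; apply: eqAB.
Qed.

(** * Arithmetic of the reading order *)

Section ReadingOrder.

Variables d' r : nat.
Local Notation d := d'.+1.

(* Position, in reading order, of the first cell of row i. *)
Definition row_start (i : nat) : nat := (minn i r * d + (i - r))%N.

(* Position of the cell (i, j) in reading order. *)
Definition cell_pos (i j : nat) : nat :=
  (row_start i + (if i < r then j else 0))%N.

(** The full rows occupy the positions below [r * d]; from there on, row and position advance
    together. *)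
Definition pos_row (p : nat) : nat :=
  if (p < r * d)%N then (p %/ d)%N else (p - r * d + r)%N.

Lemma pos_rowK i j : (j < d)%N -> pos_row (cell_pos i j) = i.
Proof.
rewrite /pos_row /cell_pos /row_start => lt_jd; case: (ltnP i r) => [lt_ir | le_ri].
  have -> : (i - r = 0)%N by lia.
  rewrite addn0.
  have le_d : (i.+1 * d <= r * d)%N by rewrite leq_mul2r lt_ir orbT.
  rewrite ifT; first by rewrite divnMDl // divn_small ?addn0.
  by rewrite mulSn in le_d; lia.
by rewrite addn0 ifF; lia.
Qed.

Lemma cell_pos_anchor i j : (j < d)%N -> (i < r)%N ->
  (cell_pos i j < r * d)%N /\ (cell_pos i j %% d = j)%N.
Proof.
rewrite /cell_pos /row_start => lt_jd lt_ir.
have -> : (i - r = 0)%N by lia.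
rewrite lt_ir (minn_idPl (ltnW lt_ir)) addn0 modnMDl modn_small //; split => //.
have : (i.+1 * d <= r * d)%N by rewrite leq_mul2r lt_ir orbT.
by rewrite mulSn; lia.
Qed.

(** The column is constrained only in the full rows: in a later row all columns share one
    position. *)
Lemma cell_pos_rowK p j : ((p < r * d)%N -> j = (p %% d)%N) ->
  cell_pos (pos_row p) j = p.
Proof.
rewrite /pos_row /cell_pos /row_start; case: ltnP => [lt_p -> // | le_p _].
  have lt_r : (p %/ d < r)%N by rewrite ltn_divLR.
  have -> : (p %/ d - r = 0)%N by lia.
  by rewrite lt_r (minn_idPl (ltnW lt_r)) addn0 -divn_eq.
rewrite ifF; last by lia.
have -> : (minn (p - r * d + r) r = r)%N by lia.
by lia.
Qed.

Lemma cell_pos_mono i i' j : (j < d)%N -> (i <= i')%N ->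
  (cell_pos i j <= cell_pos i' j)%N.
Proof.
rewrite /cell_pos /row_start => lt_jd le_ii'.
case: (ltnP i r) => [lt_ir | le_ri]; case: (ltnP i' r) => [lt_ir' | le_ri'].
- by rewrite !leq_add ?leq_mul //; lia.
- have : (i.+1 * d <= r * d)%N by rewrite leq_mul2r lt_ir orbT.
  by rewrite mulSn; lia.
- by lia.
- by lia.
Qed.

End ReadingOrder.

(** * Cells, positions and the minors of an anchored labelling *)

Section Layout.

Variables n d' r : nat.
Local Notation d := d'.+1.
Local Notation N := (nrows n d r).
Hypothesis (le_rd_n : (r * d <= n)%N).

Lemma nrowsE : N = (n - r * d + r)%N.
Proof. rewrite /nrows /=; nia. Qed.

Lemma cell_pos_ltn i j : (i < N)%N -> (j < d)%N -> (cell_pos d' r i j < n)%N.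
Proof.
rewrite nrowsE /cell_pos /row_start => lt_iN lt_jd.
case: (ltnP i r) => [lt_ir | le_ri].
  have : (i.+1 * d <= r * d)%N by rewrite leq_mul2r lt_ir orbT.
  rewrite mulSn; lia.
lia.
Qed.

Lemma pos_row_ltn p : (p < n)%N -> (pos_row d' r p < N)%N.
Proof.
rewrite nrowsE /pos_row => lt_pn; case: (ltnP p (r * d)) => [lt_p | le_p]; last by lia.
by rewrite ltn_addl // ltn_divLR.
Qed.

(** For [r <= i] the result does not depend on [j]: the row has a single entry, and it is a
    labelling that tells its column. *)
Definition cell (i : 'I_N) (j : 'I_d) : 'I_n :=
  Ordinal (cell_pos_ltn (ltn_ord i) (ltn_ord j)).

Definition row_of (p : 'I_n) : 'I_N := Ordinal (pos_row_ltn (ltn_ord p)).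

Definition row_var (p : 'I_n) : 'I_n :=
  widen_ord (leq_subr (d.-1 * r) n) (row_of p).

(* In the rows i < r every cell is filled, so the column of the p-th cell in
   reading order is forced to be p mod d. *)
Definition anchored (f : 'I_n -> 'I_d) : bool :=
  [forall p : 'I_n, (p < r * d)%N ==> (val (f p) == p %% d :> nat)%N].

Implicit Types (f : 'I_n -> 'I_d) (i : 'I_N) (j k : 'I_d).

Lemma row_of_cell i j : row_of (cell i j) = i.
Proof. by apply: val_inj; rewrite /= pos_rowK. Qed.

Lemma cell_row_of f p : anchored f -> cell (row_of p) (f p) = p.
Proof.
move/forallP/(_ p)/implyP => fp; apply: val_inj.
by rewrite /= cell_pos_rowK // => /fp/eqP.
Qed.

Lemma anchored_cell f i j : anchored f -> (i < r)%N -> f (cell i j) = j.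
Proof.
move=> /forallP/(_ (cell i j))/implyP + lt_ir.
have [lt_p mod_p] := cell_pos_anchor (ltn_ord j) lt_ir.
by rewrite [val _]/= mod_p => /(_ lt_p)/eqP/val_inj.
Qed.

Lemma row_of_incr f p q : anchored f -> f p = f q -> (p < q)%N ->
  (row_of p < row_of q)%N.
Proof.
move=> anc_f f_pq; apply: contraTT; rewrite -!leqNgt => le_row.
rewrite -(cell_row_of p anc_f) -(cell_row_of q anc_f) f_pq.
exact: cell_pos_mono.
Qed.

Lemma enum_row_var f k : anchored f ->
  enum (row_var @: fiber f k) = map row_var (enum (fiber f k)).
Proof.
move=> anc_f; apply: enum_imset_incr => p q; rewrite !inE => /eqP fp /eqP fq.
by apply: row_of_incr (anc_f) _; rewrite fp fq.
Qed.

Variable K : fieldType.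

Let X : 'M[{mpoly K[n * n]}]_n := rowsub row_var (generic_mx K n).

(** Positions with the same label lie in increasing rows, so both sides list the rows in the same
    order and no sign appears. *)
Lemma minor_row_var f k (J : {set 'I_n}) :
    anchored f -> #|fiber f k| = #|J| ->
  minor K (row_var @: fiber f k) J =
    \det (\matrix_(a < #|fiber f k|, b < #|fiber f k|)
            X (enum_val a) (nth (enum_val a) (enum J) b)).
Proof.
move=> anc_f cardJ; rewrite /minor; apply: det_ord_val => [|a b a' b' /= ea eb].
  by rewrite !cardE enum_row_var // size_map.
have ltb : (b' < size (enum J))%N by rewrite -cardE -cardJ.
rewrite !mxE eb (enum_val_nth (row_var (enum_val a'))) enum_row_var //.
rewrite (nth_map (enum_val a')) -?cardE ?ea // -enum_val_nth.
(* The two [nth] have different defaults; by [ltb] neither is reached. *)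
by congr ('X_(mxvec_index _ _)); apply: set_nth_default.
Qed.

(** Evaluates the terms of both expansions: those indexed by tableaux and those of the Laplace
    expansion. *)
Lemma det_anchored f (B : {ffun 'I_d -> {set 'I_n}})
    (covB : ordered_cover B) (balB : balanced f B) :
    anchored f ->
  \det (\matrix_(p, q) (X p q *+ (q \in B (f p)))) =
    (-1) ^+ perm (transfer_inj covB balB)
      * \prod_k minor K (row_var @: fiber f k) (B k).
Proof.
move=> anc_f; rewrite (det_block_shuffle (s := perm (transfer_inj covB balB))).
  congr (_ * _); apply: eq_bigr => k _; rewrite minor_row_var //.
  by apply/eqP; apply: (forallP balB).
by move=> k; rewrite -(map_transfer _ balB); apply: eq_map => p; rewrite permE.
Qed.

End Layout.

(** * Jellyfish tableaux as anchored balanced labellings *)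

Lemma pmap_if (S T : Type) (a : pred S) (g : S -> T) (s : seq S) :
  pmap (fun x => if a x then Some (g x) else None) s = map g (filter a s).
Proof. by elim: s => //= x s IHs; case: (a x); rewrite /= IHs. Qed.

(** Recovers a column of a tableau from its word once its nonempty cells are known. *)
Lemma pmap_support_inj (S : eqType) (T : Type) (u v : S -> option T) (s : seq S) :
    {in s, forall x, isSome (u x) = isSome (v x)} -> pmap u s = pmap v s ->
  {in s, u =1 v}.
Proof.
elim: s => //= x s IHs eq_supp.
have := eq_supp x (mem_head x s); case ux: (u x) => [y|]; case vx: (v x) => [z|] //= _.
  case=> e eq_s t; rewrite inE => /predU1P[->|]; first by rewrite ux vx e.
  by apply: IHs eq_s _ => w ws; apply: eq_supp; rewrite inE ws orbT.
move=> eq_s t; rewrite inE => /predU1P[->|]; first by rewrite ux vx.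
by apply: IHs eq_s _ => w ws; apply: eq_supp; rewrite inE ws orbT.
Qed.

Lemma flatten_iota (e : nat -> nat) m : {homo e : i j / (i <= j)%N} ->
  flatten [seq iota (e i) (e i.+1 - e i) | i <- iota 0 m] = iota (e 0%N) (e m - e 0%N).
Proof.
move=> e_mono; elim: m => [|m IHm]; first by rewrite subnn.
rewrite -addn1 iotaD map_cat flatten_cat IHm /= cats0 add0n addn1.
have [le0 le1] := (e_mono _ _ (leq0n m), e_mono _ _ (leqnSn m)).
have -> : (e m.+1 - e 0 = (e m - e 0) + (e m.+1 - e m))%N by lia.
by rewrite iotaD subnKC.
Qed.

Section Tableaux.

Variables n d' r : nat.
Local Notation d := d'.+1.
Local Notation N := (nrows n d r).
Hypothesis (le_rd_n : (r * d <= n)%N).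
Variable B : {ffun 'I_d -> {set 'I_n}}.
Hypothesis (covB : ordered_cover B).

Implicit Types (f : 'I_n -> 'I_d) (i : 'I_N) (j k : 'I_d) (T : tableau n d r).

Local Notation cell := (cell le_rd_n).
Local Notation row_of := (row_of le_rd_n).
Local Notation row_var := (row_var le_rd_n).

Lemma cell_free i j k : (r <= i)%N -> cell i j = cell i k.
Proof.
by move=> le_ri; apply: val_inj; rewrite /= /cell_pos ltnNge le_ri.
Qed.

(** Going down column [k] meets the positions labelled [k] in increasing order. *)
Lemma enum_fiber f k : anchored r f ->
  enum (fiber f k) = [seq cell i k | i <- enum 'I_N & f (cell i k) == k].
Proof.
move=> anc_f; apply/esym/sorted_eq_enum => [|p].
  rewrite sorted_map; apply: sorted_filter.
    by move=> i' i i''; apply: ltn_trans.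
  have := iota_ltn_sorted 0 N; rewrite -val_enum_ord sorted_map.
  (* [cell_pos_mono] is only weak; strictness holds because [row_of] recovers the row. *)
  apply: sub_sorted => i i' /= lt_ii'; rewrite ltn_neqAle; apply/andP; split.
    apply: contraTneq lt_ii' => e.
    have /(congr1 row_of) : cell i k = cell i' k by apply: val_inj.
    by rewrite !row_of_cell => ->; rewrite ltnn.
  by apply: cell_pos_mono => //; apply: ltnW.
apply/mapP/idP => [[i + ->] | fp].
  by rewrite mem_filter inE => /andP[].
move: fp; rewrite inE => /eqP fp; exists (row_of p).
  by rewrite mem_filter mem_enum inE -fp cell_row_of // !eqxx.
by rewrite -fp cell_row_of.
Qed.

(** Row [i] covers the positions from [row_start i] up to [row_start i.+1], that is [d] of them if
    [i < r] and one otherwise; these intervals tile the positions. *)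
Lemma enum_cells f : anchored r f ->
  flatten [seq [seq cell i j | j <- enum 'I_d & f (cell i j) == j] | i <- enum 'I_N]
  = enum 'I_n.
Proof.
move=> anc_f; apply: (inj_map val_inj); rewrite val_enum_ord.
have row_iota i :
    map val [seq cell i j | j <- enum 'I_d & f (cell i j) == j]
    = iota (row_start d' r i) (row_start d' r i.+1 - row_start d' r i).
  case: (ltnP i r) => [lt_ir | le_ri].
    rewrite (eq_filter (a2 := predT)) => [|j]; last by rewrite anchored_cell ?eqxx.
    rewrite filter_predT -map_comp.
    rewrite (eq_map (g := addn (row_start d' r i) \o val)) => [|j]; last first.
      by rewrite /= /cell_pos lt_ir.
    rewrite map_comp val_enum_ord -iotaDl addn0; congr iota.
    by rewrite /row_start (minn_idPl lt_ir) (minn_idPl (ltnW lt_ir)) mulSn; lia.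
  have -> : (row_start d' r i.+1 - row_start d' r i = 1)%N.
    by rewrite /row_start (minn_idPr le_ri) (minn_idPr (leqW le_ri)); lia.
  rewrite (eq_filter (a2 := pred1 (f (cell i ord0)))) => [|j]; last first.
    by rewrite /= eq_sym (cell_free j ord0).
  rewrite filter_pred1_uniq ?enum_uniq ?mem_enum //=.
  by rewrite /cell_pos ltnNge le_ri addn0.
pose start_iota m := iota (row_start d' r m) (row_start d' r m.+1 - row_start d' r m).
rewrite map_flatten -map_comp (eq_map (g := start_iota \o val)); last exact: row_iota.
rewrite map_comp val_enum_ord flatten_iota.
  by rewrite /row_start nrowsE // min0n mul0n sub0n subn0; congr iota; lia.
move=> i i' le_ii'; rewrite /row_start leq_add ?leq_mul ?leq_sub //.
by rewrite leq_min !geq_min le_ii' leqnn orbT.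
Qed.

(** The label of a position is the column of its entry; [transfer] fills each column increasingly
    with its block. *)
Definition label_tableau f : tableau n d r :=
  \matrix_(i, j) if f (cell i j) == j then Some (transfer f B (cell i j)) else None.

Lemma label_tableau_neq0 f i j : (label_tableau f i j != None) = (f (cell i j) == j).
Proof. by rewrite mxE; case: (_ == j). Qed.

Lemma col_rows_label_tableau f k : anchored r f ->
  col_rows (label_tableau f) k = row_var @: fiber f k.
Proof.
move=> anc_f; apply/setP => p; apply/imsetP/imsetP => [[i + ->] | [q + ->]].
  rewrite inE label_tableau_neq0 => fi; exists (cell i k); rewrite ?inE //.
  by apply: val_inj; rewrite /= pos_rowK.
rewrite inE => /eqP fq; exists (row_of q) => //.
by rewrite inE label_tableau_neq0 -fq cell_row_of.
Qed.

Lemma col_word_label_tableau f k : anchored r f -> balanced f B ->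
  col_word (label_tableau f) k = enum (B k).
Proof.
move=> anc_f balf; rewrite -(map_transfer _ balf) enum_fiber // -map_comp -pmap_if.
by apply: eq_pmap => i; rewrite mxE.
Qed.

Lemma reading_word_label_tableau f : anchored r f ->
  reading_word (label_tableau f) = map (transfer f B) (enum 'I_n).
Proof.
move=> anc_f; rewrite -(enum_cells anc_f) map_flatten -map_comp; congr flatten.
apply: eq_map => i /=; rewrite -map_comp -pmap_if.
by apply: eq_pmap => j; rewrite mxE.
Qed.

Lemma jellyfish_label_tableau f : anchored r f -> balanced f B ->
  jellyfish B (label_tableau f).
Proof.
move=> anc_f balf; apply/and3P; split.
- apply/'forall_'forall_implyP => i j lt_ir.
  by rewrite label_tableau_neq0 anchored_cell.
- apply/'forall_implyP => i le_ri; apply/cards1P; exists (f (cell i ord0)).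
  by apply/setP => j; rewrite !inE label_tableau_neq0 (cell_free j ord0) // eq_sym.
- apply/forallP => k; rewrite col_word_label_tableau // sorted_enum andbT.
  by apply/eqP/setP => q; rewrite inE mem_enum.
Qed.

Lemma label_tableau_inj f f' : anchored r f -> label_tableau f = label_tableau f' -> f =1 f'.
Proof.
move=> anc_f e p; apply/esym/eqP; rewrite -{1}(cell_row_of le_rd_n p anc_f).
by rewrite -label_tableau_neq0 -e label_tableau_neq0 cell_row_of.
Qed.

(** Every position carries exactly one entry, whose column is taken as its label. As columns
    increase, the blocks then determine the entries. *)
Lemma jellyfish_label T : jellyfish B T ->
  exists f, [/\ anchored r f, balanced f B & T = label_tableau f].
Proof.
case/and3P => /'forall_'forall_implyP top /'forall_implyP bot /forallP cols.
have [f fP] : exists f : 'I_n -> 'I_d, forall p,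
    exists i, cell i (f p) = p /\ T i (f p) != None.
  apply: (@fin_all_exists _ _ (fun p j => exists i, cell i j = p /\ T i j != None)).
  move=> p; case: (ltnP p (r * d)) => [lt_p | le_p].
    exists (inord (p %% d)), (row_of p); split.
      by apply: val_inj; rewrite /= cell_pos_rowK // inordK // ltn_mod.
    by apply: top; rewrite /= /pos_row lt_p ltn_divLR.
  have /cards1P[j Tj] : #|[set j | T (row_of p) j != None]| == 1%N.
    by apply: bot; rewrite /= /pos_row ltnNge le_p leq_addl.
  exists j, (row_of p); split.
    by apply: val_inj; rewrite /= cell_pos_rowK // ltnNge le_p.
  by have := set11 j; rewrite -Tj inE.
have f_row p i : cell i (f p) = p -> i = row_of p by move=> <-; rewrite row_of_cell.
have fT i j : (T i j != None) = (f (cell i j) == j).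
  have [i' [ei' Ti']] := fP (cell i j).
  have e := f_row _ _ ei'; rewrite row_of_cell in e; subst i'.
  apply/idP/eqP => [Tij | <- //].
  (* In a full row the position modulo [d] gives the column; in a later row the nonempty cell is
     unique. *)
  case: (ltnP i r) => [lt_ir | le_ri].
    have := congr1 (fun p : 'I_n => (p %% d)%N) ei'.
    by rewrite /= !(cell_pos_anchor _ _).2 // => /val_inj.
  have /cards1P[k Tk] := bot i le_ri.
  have inTk j' : T i j' != None -> j' = k by move=> Tj'; apply/set1P; rewrite -Tk inE.
  by rewrite (inTk _ Ti') (inTk _ Tij).
have anc_f : anchored r f.
  apply/'forall_implyP => p lt_p; have [i [ei _]] := fP p.
  have lt_ir : (i < r)%N by rewrite (f_row _ _ ei) /= /pos_row lt_p ltn_divLR.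
  have [_ mod_f] := cell_pos_anchor (ltn_ord (f p)) lt_ir.
  by rewrite -{2}ei /= mod_f.
have colT k : col_word T k = enum (B k).
  have /andP[/eqP <- srt] := cols k.
  by apply: sorted_eq_enum => // x; rewrite inE.
have balf : balanced f B.
  apply/forallP => k; rewrite !cardE -colT enum_fiber // size_map size_filter size_pmap.
  by apply/eqP/eq_count => i; rewrite /= -fT; case: (T i k).
exists f; split=> //; apply/matrixP => i j.
apply: (pmap_support_inj (s := enum 'I_N) (u := T^~ j) (v := (label_tableau f)^~ j)).
- move=> i' _ /=; have := fT i' j; rewrite -label_tableau_neq0.
  by case: (T i' j); case: (label_tableau f i' j).
- by rewrite -/(col_word _ j) colT -/(col_word _ j) col_word_label_tableau.
- by rewrite mem_enum.
Qed.

Variable K : fieldType.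

(** The reading word of a tableau is the one-line notation of its [transfer] permutation, so the
    sign of the tableau is the sign in [det_anchored]. *)
Lemma jellyfish_invariant_det :
  jellyfish_invariant r K B =
    \sum_(f : {ffun 'I_n -> 'I_d} | anchored r f && balanced f B)
      \det (\matrix_(p, q) (rowsub row_var (generic_mx K n) p q *+ (q \in B (f p)))).
Proof.
have jellyE : [set T | jellyfish B T] =
    (fun f : {ffun 'I_n -> 'I_d} => label_tableau f)
      @: [set f : {ffun 'I_n -> 'I_d} | anchored r f && balanced f B].
  apply/setP => T; rewrite inE; apply/idP/imsetP => [jT | [f + ->]]; last first.
    by rewrite inE => /andP[]; apply: jellyfish_label_tableau.
  have [f [anc_f balf ->]] := jellyfish_label jT.
  (* The sum ranges over finite functions, while [jellyfish_label] gives a plain one. *)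
  have fE : finfun f =1 f by apply: ffunE.
  exists (finfun f).
    rewrite inE; apply/andP; split.
      by apply/forallP => p; rewrite fE (forallP anc_f).
    apply/forallP => k; rewrite -(eqP (forallP balf k)); apply/eqP.
    by apply: eq_card => p; rewrite !inE fE.
  apply/matrixP => i j; rewrite !mxE fE /transfer fE.
  suff -> : fiber (finfun f) (f (cell i j)) = fiber f (f (cell i j)) by [].
  by apply/setP => p; rewrite !inE fE.
rewrite /jellyfish_invariant (eq_bigl (mem [set T | jellyfish B T])) => [|T]; last first.
  by rewrite /= inE.
rewrite jellyE big_imset /=; last first.
  move=> f f'; rewrite !inE => /andP[anc_f _] _ /(label_tableau_inj anc_f) eq_f.
  exact/ffunP.
rewrite (eq_bigl (fun f : {ffun 'I_n -> 'I_d} => anchored r f && balanced f B)) => [|f]; last first.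
  by rewrite inE.
apply: eq_bigr => f /andP[anc_f balf].
rewrite (det_anchored le_rd_n _ covB balf) // -sign_inversions; congr (_ ^+ _ * _).
  rewrite /inv_tab reading_word_label_tableau // -map_comp.
  by congr inversions; apply: eq_map => p; rewrite /= permE.
by apply: eq_bigr => k _; rewrite col_rows_label_tableau.
Qed.

End Tableaux.

(** * The two expansions of the matrix Z and membership in the span *)

Lemma ordered_cover_card_le n d r (B : {ffun 'I_d -> {set 'I_n}}) :
  ordered_cover B -> (forall j, (r <= #|B j|)%N) -> (r * d <= n)%N.
Proof.
move=> /ordered_cover_label[g gB] le_r.
have -> : (r * d = \sum_(j < d) r)%N by rewrite sum_nat_const card_ord mulnC.
have -> : n = (\sum_(j < d) #|B j|)%N.
  rewrite -[LHS]card_ord -sum1_card (partition_big g predT) //=.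
  apply: eq_bigr => j _; rewrite sum1_card; apply: eq_card => q.
  by rewrite gB.
by apply: leq_sum.
Qed.

Lemma card_ord_lt n m : (m <= n)%N -> #|[set a : 'I_n | (a < m)%N]| = m.
Proof.
move=> le_mn; have -> : [set a : 'I_n | (a < m)%N] = widen_ord le_mn @: [set: 'I_m].
  apply/setP => a; rewrite inE; apply/idP/imsetP => [lt_am | [b _ ->] //=].
  by exists (Ordinal lt_am); rewrite ?inE //; apply: val_inj.
by rewrite card_imset ?cardsT ?card_ord // => x y /(congr1 val)/= /val_inj.
Qed.

Section Membership.

Variables n d' r : nat.
Local Notation d := d'.+1.
Hypothesis (le_rd_n : (r * d <= n)%N).
Variable B : {ffun 'I_d -> {set 'I_n}}.
Hypothesis (covB : ordered_cover B).
Variable K : fieldType.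

Local Notation row_of := (row_of le_rd_n).
Local Notation row_var := (row_var le_rd_n).
Local Notation X := (rowsub row_var (generic_mx K n)).

(* The rows labelled ord0 are those of the tall minor of a generator. *)
Definition base_label (p : 'I_n) : 'I_d :=
  if (p < r * d)%N then inord (p %% d) else ord0.

(** This is Z, with its rows in reading order. *)
Definition flamingo_mx : 'M[{mpoly K[n * n]}]_n :=
  \matrix_(p, q) (X p q *+ ((base_label p == ord0) || (q \in B (base_label p)))).

Lemma anchored_base_label : anchored r base_label.
Proof.
by apply/'forall_implyP => p lt_p; rewrite /base_label lt_p /= inordK // ltn_mod.
Qed.

Lemma anchored_base (f : 'I_n -> 'I_d) (p : 'I_n) :
  anchored r f -> (p < r * d)%N -> f p = base_label p.
Proof.
move=> /'forall_implyP anc_f lt_p; apply: val_inj; apply/eqP.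
rewrite (eqP (anc_f p lt_p)) eq_sym.
by have /'forall_implyP := anchored_base_label; apply.
Qed.

(** Row [p] is supported on the block [base_label p], so its restriction to another block is
    zero. *)
Lemma det_mislabelled (f : 'I_n -> 'I_d) (p : 'I_n) :
    base_label p != ord0 -> f p != base_label p ->
  \det (\matrix_(x, q) (flamingo_mx x q *+ (q \in B (f x)))) = 0.
Proof.
move=> /negPf p0 neq_p; rewrite (expand_det_row _ p) big1 // => q _.
rewrite !mxE p0 /=; have [g gB] := ordered_cover_label covB; rewrite !gB.
case: (g q =P f p) => [-> | _]; last by rewrite mulr0n mul0r.
by rewrite (negPf neq_p) !mulr0n mul0rn mul0r.
Qed.

(* If some cell (i, 0) carries a label k != 0, then the rows at (i, 0) and
   (i, k) coincide after restriction to the columns of B k. *)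
Lemma det_not_anchored (f : 'I_n -> 'I_d) : ~~ anchored r f ->
  \det (\matrix_(p, q) (flamingo_mx p q *+ (q \in B (f p)))) = 0.
Proof.
case/forallPn => p; rewrite negb_imply => /andP[lt_p neq_p].
have neq_fp : f p != base_label p.
  by rewrite -val_eqE /= /base_label lt_p inordK // ltn_mod.
case: (eqVneq (base_label p) ord0) => [p0 | /det_mislabelled]; last by apply.
have row_p : (row_of p < r)%N by rewrite /= /pos_row lt_p ltn_divLR.
pose p' := cell le_rd_n (row_of p) (f p).
have base_p' : base_label p' = f p.
  exact: anchored_cell anchored_base_label row_p.
have fp0 : f p != ord0 by rewrite -p0.
(* Either row [p'] is itself mislabelled and vanishes, or it has the same label as [p] and the two
   rows agree. *)
case: (eqVneq (f p') (base_label p')) => [fp' | /det_mislabelled]; last first.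
  by apply; rewrite base_p'.
apply: (determinant_alternate (i1 := p) (i2 := p')) => [|q].
  by apply: contraNneq neq_fp => ->; rewrite fp'.
rewrite !mxE fp' base_p' p0 eqxx (negPf fp0) /=.
have -> : row_var p' = row_var p by apply: val_inj; rewrite /= pos_rowK.
by case: (q \in _).
Qed.

(** For an anchored [f], the restriction to [B (f p)] already implies the one built into
    [flamingo_mx]; the other labellings contribute nothing. *)
Lemma jellyfish_invariant_flamingo_mx : jellyfish_invariant r K B = \det flamingo_mx.
Proof.
rewrite (jellyfish_invariant_det le_rd_n covB) big_mkcond.
rewrite [RHS](det_expand_row_labels _ covB).
apply: eq_bigr => f _; case: (boolP (anchored r f)) => [anc_f | /det_not_anchored //].
have -> : \matrix_(p, q) (flamingo_mx p q *+ (q \in B (f p)))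
    = \matrix_(p, q) (X p q *+ (q \in B (f p))).
  apply/matrixP => p q; rewrite !mxE; case: (boolP (q \in B (f p))) => // qB.
  case: (ltnP p (r * d)) => [/(anchored_base anc_f) <- | le_p].
    by rewrite qB orbT.
  by rewrite /base_label ltnNge le_p eqxx.
by case: (boolP (balanced f B)) => [// | unb]; rewrite det_unbalanced.
Qed.

(** This makes the minors top-justified: a label [k > 0] occurs once in each row [i < r], the label
    0 once in every row. *)
Lemma row_var_fiber_base (k : 'I_d) :
  row_var @: fiber base_label k = [set a : 'I_n | (a < flamingo_col n d r k)%N].
Proof.
have le_r : (r <= nrows n d r)%N by rewrite nrowsE // leq_addl.
apply/setP => a; apply/imsetP/idP => [[p + ->] | ]; rewrite !inE.
  move=> /eqP <-; rewrite /flamingo_col /base_label.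
  case: (ltnP p (r * d)) => [lt_p | le_p]; last by rewrite -nrowsE //= pos_row_ltn.
  case: ifP => _; first by rewrite -nrowsE //= pos_row_ltn.
  by rewrite /= /pos_row lt_p ltn_divLR.
move=> lt_a; have lt_aN : (a < nrows n d r)%N.
  move: lt_a; rewrite /flamingo_col -nrowsE //; case: ifP => // _ lt_ar.
  exact: leq_trans lt_ar le_r.
exists (cell le_rd_n (Ordinal lt_aN) k); last first.
  by apply: val_inj; rewrite /= pos_rowK.
rewrite inE; case: (ltnP a r) => [lt_ar | le_ra].
  by rewrite anchored_cell ?anchored_base_label.
(* Only the tall minor, [k = 0], reaches a row [a] with [r <= a]. *)
have k0 : k = ord0.
  apply: val_inj; move: lt_a; rewrite /flamingo_col.
  by case: eqP => //= _; rewrite ltnNge le_ra.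
rewrite k0 /base_label /= /cell_pos /row_start (minn_idPr le_ra).
by rewrite ifF // -addnA; apply/negbTE; rewrite -leqNgt leq_addr.
Qed.

Lemma card_fiber_base (k : 'I_d) : #|fiber base_label k| = flamingo_col n d r k.
Proof.
have le_col : (flamingo_col n d r k <= n)%N.
  by rewrite /flamingo_col; case: eqP => _; nia.
rewrite -(card_ord_lt le_col) -row_var_fiber_base.
by rewrite !cardE enum_row_var ?anchored_base_label // size_map.
Qed.

Lemma flamingo_indexE (J : {ffun 'I_d -> {set 'I_n}}) :
  flamingo_index r J = ordered_cover J && balanced base_label J.
Proof.
congr (_ && _); apply: eq_forallb => k.
by rewrite card_fiber_base eq_sym.
Qed.

(** If some [J k] with [k > 0] leaves [B k], a column of the matrix is zero and so is the scalar.
    Otherwise the restrictions in [flamingo_mx] have no effect and the scalar is a sign. *)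
Lemma det_flamingo_term (J : {ffun 'I_d -> {set 'I_n}}) : flamingo_index r J ->
  exists a : K, \det (\matrix_(p, q) (flamingo_mx p q *+ (q \in J (base_label p))))
    = a *: flamingo_generator r K J.
Proof.
rewrite flamingo_indexE => /andP[covJ balJ].
case: (boolP [exists k, (k != ord0) && ~~ (J k \subset B k)]) => [| /existsPn subJ].
  case/existsP => k /andP[/negPf k0 /subsetPn[q qJ /negPf qB]]; exists 0.
  rewrite scale0r (expand_det_col _ q) big1 // => p _; rewrite !mxE.
  have [g gJ] := ordered_cover_label covJ; move: qJ; rewrite !gJ => /eqP ->.
  case: (k =P base_label p) => [<- | _]; last by rewrite mulr0n mul0r.
  by rewrite k0 qB mulr0n mul0rn mul0r.
exists ((-1) ^+ perm (transfer_inj covJ balJ)).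
have -> : \matrix_(p, q) (flamingo_mx p q *+ (q \in J (base_label p)))
    = \matrix_(p, q) (X p q *+ (q \in J (base_label p))).
  apply/matrixP => p q; rewrite !mxE; case: (boolP (q \in J _)) => // qJ.
  have := subJ (base_label p); case: eqP => //= _.
  by rewrite negbK => /subsetP ->.
rewrite (det_anchored le_rd_n _ covJ balJ) ?anchored_base_label //.
rewrite scaler_sign mulr_sign /flamingo_generator.
by under eq_bigr do rewrite row_var_fiber_base.
Qed.

Lemma jellyfish_invariant_flamingo : flamingo_specht n d r (jellyfish_invariant r K B).
Proof.
(* Finite choice gathers the scalars of [det_flamingo_term] into one coefficient function. *)
have [J_coef coefP] : exists c : {ffun 'I_d -> {set 'I_n}} -> K, forall J,
    flamingo_index r J ->
    \det (\matrix_(p, q) (flamingo_mx p q *+ (q \in J (base_label p))))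
      = c J *: flamingo_generator r K J.
  apply: (@fin_all_exists _ _ (fun J a => flamingo_index r J ->
    \det (\matrix_(p, q) (flamingo_mx p q *+ (q \in J (base_label p))))
      = a *: flamingo_generator r K J)) => J.
  case: (boolP (flamingo_index r J)) => [/det_flamingo_term[a ->] | _]; last by exists 0.
  by exists a.
exists J_coef; rewrite jellyfish_invariant_flamingo_mx (det_expand_col_labels base_label).
by apply: eq_big => [J | J]; rewrite -flamingo_indexE // => /coefP.
Qed.

End Membership.

Theorem theorem4p15 (R : realType) (n d r : nat)
    (n_gt0 : (0 < n)%N) (d_gt0 : (0 < d)%N) (r_gt0 : (0 < r)%N)
    (pi : {ffun 'I_d -> {set 'I_n}}) (pi_OP : pi \in OP n d r) :
  flamingo_specht n d r (jellyfish_invariant r (complex R) pi).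
Proof.
case: d d_gt0 pi pi_OP => // d' _ pi; rewrite inE => /and3P[cov_pi _ /forallP le_r].
exact: (jellyfish_invariant_flamingo (ordered_cover_card_le cov_pi le_r) cov_pi).
Qed.
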